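(* Let $n$ be any positive integer. Then for all integers $k\geq 3$, $$A_n(12\cdots k)=A_n(213\cdots k),$$ where $12\cdots k$ is the increasing permutation of length $k$, and $213\cdots k$ denotes the permutation $2\,1\,3\,4\cdots k$ of length $k$, obtained from $12\cdots k$ by interchanging its first two entries.
   Context: A permutation of length $n$ is written in one-line notation $p=p_1p_2\cdots p_n$, a rearrangement of $1,2,\dots,n$. Let $q=q_1q_2\cdots q_k$ be a permutation of length $k$. The permutation $p$ avoids the pattern $q$ if there are no $k$ indices $i_1<i_2<\cdots<i_k$ such that for all $a$ and $b$, $p_{i_a}<p_{i_b}$ holds if and only if $q_a<q_b$ holds (in particular, if $k>n$, then $p$ avoids $q$ trivially). The permutation $p$ is called alternating if $p_1<p_2>p_3<p_4>\cdots$, that is, for every $1\le i\le n-1$, $p_i<p_{i+1}$ if and only if $i$ is odd. $A_n(q)$ denotes the number of alternating permutations of length $n$ that avoid the pattern $q$. *)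

(* Defs.v *)
From mathcomp Require Import all_boot all_fingroup.

Set Implicit Arguments.
Unset Strict Implicit.
Unset Printing Implicit Defensive.

(* A permutation of length n is an element p of 'S_n.  Positions and values are
   both shifted down by one: p_i is (p (i - 1)) + 1. *)

Definition contains_pattern (n k : nat) (p : 'S_n) (q : 'S_k) : bool :=
  [exists f : {ffun 'I_k -> 'I_n},
     [forall a : 'I_k, forall b : 'I_k, (a < b) ==> (f a < f b)] &&
     [forall a : 'I_k, forall b : 'I_k, (p (f a) < p (f b)) == (q a < q b)]].

Definition avoids (n k : nat) (p : 'S_n) (q : 'S_k) : bool :=
  ~~ contains_pattern p q.

(* An ascent occurs exactly at the odd positions counted from 1, that is at the
   even positions counted from 0. *)
Definition alternating (n : nat) (p : 'S_n) : bool :=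
  [forall i : 'I_n, forall j : 'I_n,
     (j == i.+1 :> nat) ==> ((p i < p j) == ~~ odd i)].

Definition num_alt_avoiding (n k : nat) (q : 'S_k) : nat :=
  #|[set p : 'S_n | alternating p && avoids p q]|.

Definition increasing_pattern (k : nat) : 'S_k := 1%g.

(* For k < 2 there are no two entries to interchange, and the value is a dummy. *)
Definition swapped_pattern (k : nat) : 'S_k :=
  match k return 'S_k with
  | m.+2 => tperm (inord 0) (inord 1)
  | _ => 1%g
  end.

(* Main.v *)
Require Import Defs.
From mathcomp Require Import all_boot all_fingroup.
From mathcomp Require Import zify.

Set Implicit Arguments.
Unset Strict Implicit.
Unset Printing Implicit Defensive.

(** Put l = k - 2.  Call a point (x, v) of the square a cell of the board of p
    if p has an increasing subsequence of length l strictly to its right and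
    strictly above it, and call an entry of p low if it lies on the board.  The
    board is closed under moving left and down.  Then p contains 12...k iff two
    of its entries form an ascent whose upper right corner is on the board, and
    p contains 213...k iff two of its entries form a descent whose upper right
    corner is on the board.

    The board depends only on the entries that are not low ([board_high]), so
    moving the low entries around inside the board, while keeping all other
    entries, changes neither the board nor the set of positions of the low
    entries ([same_high_board], [same_high_low]).  This gives an equivalence
    relation on permutations, and each class contains exactly one permutation
    avoiding 12...k and exactly one avoiding 213...k.
    - Existence ([hit_free_exists]): exchanging the two entries of a bad pair
      stays in the class and strictly increases a suitable weight, so a member
      of maximal weight has no bad pair.
    - Uniqueness ([hit_free_unique]): at the last position where two members of
      a class differ, one of them has a bad pair.

    Matching the avoiders of the two patterns class by class is compatible with
    alternation.  In an alternating permutation avoiding either pattern, no two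
    low entries are adjacent ([low_not_adjacent]), and the comparison of
    adjacent entries of which at most one is low is the same throughout the
    class ([same_high_alternating]). *)

(** * Boards *)

(** The cells having a chain of [l] entries of [p] strictly to the right of
    position [x] and strictly above value [v]; the chain is listed by its
    positions.  Coordinates are natural numbers, so that cells need no bounds. *)
Definition board (n : nat) (l : nat) (p : 'S_n) (x v : nat) : bool :=
  [exists s : l.-tuple 'I_n,
     path ltn x [seq val j | j <- s] && path ltn v [seq val (p j) | j <- s]].

(** The entry of [p] at position [i] is itself a cell of the board. *)
Definition low (n : nat) (l : nat) (p : 'S_n) (i : 'I_n) : bool :=
  board l p i (p i).

Lemma boardP (n l : nat) (p : 'S_n) (x v : nat) :
  reflect (exists s : seq 'I_n,
             [/\ size s = l, path ltn x [seq val j | j <- s]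
               & path ltn v [seq val (p j) | j <- s]])
          (board l p x v).
Proof.
apply: (iffP existsP) => [[s /andP[sx sv]]|[s [sz sx sv]]].
  by exists s; rewrite size_tuple.
by exists (tcast sz (in_tuple s)); rewrite val_tcast sx.
Qed.

Lemma path_ltn_le (x y : nat) (s : seq nat) :
  x <= y -> path ltn y s -> path ltn x s.
Proof. by case: s => //= z s xy /andP[yz ->]; rewrite (leq_ltn_trans xy yz). Qed.

Lemma board_le (n l : nat) (p : 'S_n) (x v x' v' : nat) :
  x' <= x -> v' <= v -> board l p x v -> board l p x' v'.
Proof.
move=> xx vv /boardP[s [sz sx sv]]; apply/boardP; exists s.
by split=> //; [apply: path_ltn_le xx sx | apply: path_ltn_le vv sv].
Qed.

(** If the entry in column [j] = [i] + 1 is not above [v], no chain witnessing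
    that ([i], [v]) is on the board uses it, so ([j], [v]) is on the board too. *)
Lemma board_neighbour (n l : nat) (p : 'S_n) (i j : 'I_n) (v : nat) :
  0 < l -> val j = i.+1 -> p j <= v -> board l p i v -> board l p j v.
Proof.
move=> l0 ij pjv /boardP[[|x s] [sz sx sv]]; first by rewrite -sz in l0.
apply/boardP; exists (x :: s); split=> //.
move: sx sv => /= /andP[ix ->] /andP[vx _]; rewrite andbT.
suff: val x != val j by move: ij ix => /=; lia.
by apply/eqP => /val_inj xj; rewrite xj in vx; lia.
Qed.

(** The witnessing chain can be chosen free of low entries: if its first entry
    is low, replace the chain by one starting further to the right; if its first
    entry is not low, no later entry is, as the board is closed under moving
    left and down. *)
Lemma board_high (n l : nat) (p : 'S_n) (x v : nat) :
  board l p x v ->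
  exists s : seq 'I_n,
    [/\ size s = l, path ltn x [seq val j | j <- s],
        path ltn v [seq val (p j) | j <- s] & all (fun j => ~~ low l p j) s].
Proof.
move: {2}(n - x) (leqnn (n - x)) => d.
elim: d x v => [|d IH] x v led /boardP[[|j s] [sz sx sv]]; try by exists [::].
  by move: sx => /= /andP[xj _]; have := ltn_ord j; lia.
move: (sx) (sv) => /= /andP[xj sj] /andP[vj spj].
have [lowj|highj] := boolP (low l p j).
  have [|t [tz tx tv th]] := IH _ _ _ lowj; first by have := ltn_ord j; lia.
  exists t; split=> //; first exact: path_ltn_le (ltnW xj) tx.
  exact: path_ltn_le (ltnW vj) tv.
exists (j :: s); split=> //=; rewrite highj /=; apply/allP=> y ys.
move: sj spj; rewrite !(path_sortedE ltn_trans) => /andP[/allP js _] /andP[/allP ps _].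
apply: contra highj; apply: board_le; apply: ltnW.
  by apply: js; apply: map_f.
by apply: ps; apply: (map_f (fun y => val (p y))).
Qed.

(** * Rearranging the low entries *)

(** [r] arises from [p] by moving low entries inside the board of [p], all other
    entries being kept.  The definition refers only to the board of [p];
    symmetry and transitivity follow from [same_high_board]. *)
Definition same_high (n l : nat) (p r : 'S_n) : bool :=
  [forall x : 'I_n, (p x == r x) || (low l p x && board l p x (r x))].

Lemma same_highP (n l : nat) (p r : 'S_n) :
  reflect (forall x, p x <> r x -> low l p x /\ board l p x (r x))
          (same_high l p r).
Proof.
apply: (iffP forallP) => [H x /eqP/negPf px | H x].
  by move: (H x); rewrite px => /andP.
by case: eqP => //= /H[-> ->].
Qed.

(** Chains of entries of [p] that are not low survive in [r], so the board of
    [r] contains that of [p].  Hence chains of entries of [r] outside the board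
    of [r] consist of entries outside the board of [p], which are also entries
    of [p]. *)
Lemma same_high_board (n l : nat) (p r : 'S_n) :
  same_high l p r -> board l r =2 board l p.
Proof.
move/same_highP=> pr.
have sub x v : board l p x v -> board l r x v.
  case/board_high=> s [sz sx sv hs]; apply/boardP; exists s; split=> //.
  rewrite -(_ : [seq val (p j) | j <- s] = [seq val (r j) | j <- s]) //.
  apply/eq_in_map => j js; congr val; apply/eqP; apply/negPn/negP => /eqP /pr[lj _].
  by move/allP: hs => /(_ j js); rewrite lj.
move=> x v; apply/idP/idP; last exact: sub.
case/board_high=> s [sz sx sv hs]; apply/boardP; exists s; split=> //.
rewrite (_ : [seq val (p j) | j <- s] = [seq val (r j) | j <- s]) //.
apply/eq_in_map => j js; congr val; apply/eqP; apply/negPn/negP => /eqP /pr[_ /sub lj].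
by move/allP: hs => /(_ j js); rewrite /low lj.
Qed.

Lemma same_high_refl (n l : nat) (p : 'S_n) : same_high l p p.
Proof. by apply/same_highP. Qed.

Lemma same_high_sym (n l : nat) (p r : 'S_n) :
  same_high l p r -> same_high l r p.
Proof.
move=> pr; apply/same_highP=> x rp; rewrite /low !(same_high_board pr).
by have [] := same_highP _ _ _ pr x (nesym rp); split.
Qed.

Lemma same_high_trans (n l : nat) (p r t : 'S_n) :
  same_high l p r -> same_high l r t -> same_high l p t.
Proof.
move=> pr rt; apply/same_highP=> x pt.
have [prx|/eqP prx] := eqVneq (p x) (r x).
  rewrite /low prx -!(same_high_board pr).
  by case: (same_highP _ _ _ rt x) => //; rewrite -prx.
have [lp br] := same_highP _ _ _ pr x prx; split=> //.
have [<- //|/eqP rtx] := eqVneq (r x) (t x).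
by rewrite -(same_high_board pr); case: (same_highP _ _ _ rt x rtx).
Qed.

Lemma same_high_low (n l : nat) (p r : 'S_n) (x : 'I_n) :
  same_high l p r -> low l r x = low l p x.
Proof.
move=> pr; rewrite /low (same_high_board pr).
have [-> //|/eqP prx] := eqVneq (p x) (r x).
by case: (same_highP _ _ _ pr x prx); rewrite /low => -> ->.
Qed.

Lemma same_high_eq (n l : nat) (p r : 'S_n) (x : 'I_n) :
  same_high l p r -> ~~ low l p x -> p x = r x.
Proof.
move=> /same_highP pr h; apply/eqP; apply/negPn/negP => /eqP /pr[].
by rewrite (negPf h).
Qed.

(** * Occurrences of the two patterns *)

(** The two patterns are treated uniformly: [true] stands for the increasing
    pattern, [false] for the one with its first two entries interchanged. *)
Definition pattern (b : bool) (k : nat) : 'S_k :=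
  if b then increasing_pattern k else swapped_pattern k.

(** The entries at positions [i] and [j] are the first two of an occurrence of
    [pattern b] of length [l] + 2: they form an ascent if [b], a descent
    otherwise, and the corner given by [j] and the larger of the two values is a
    cell of the board. *)
Definition hit (n l : nat) (b : bool) (p : 'S_n) (i j : 'I_n) : bool :=
  [&& i < j, (p i < p j) == b & board l p j (if b then p j else p i)].

Definition hit_free (n l : nat) (b : bool) (p : 'S_n) : Prop :=
  forall i j, ~~ hit l b p i j.

Lemma patternE (b : bool) (m : nat) (a : 'I_m.+2) :
  pattern b m.+2 a =
  (if b || (1 < a) then a : nat else 1 - a) :> nat.
Proof.
case: b => /=; first by rewrite perm1.
case: tpermP => [->|->|]; rewrite ?inordK //.
move=> /eqP; rewrite -val_eqE /= inordK // => a0.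
move=> /eqP; rewrite -val_eqE /= inordK // => a1.
by case: ifP => //; lia.
Qed.

Lemma patternK (b : bool) (m : nat) : involutive (pattern b m.+2).
Proof.
move=> a; apply/val_inj; rewrite /= !patternE; case: b => //=.
by case: (ltnP 1 a) => [->|a1] //; rewrite ltnNge leq_subr subKn.
Qed.

Lemma contains_patternP (n m : nat) (b : bool) (p : 'S_n) :
  reflect (exists i j, hit m.+1 b p i j)
          (contains_pattern p (pattern b m.+3)).
Proof.
set q := pattern b m.+3.
apply: (iffP existsP) => [[f /andP[/forallP fI /forallP fV]]|[i [j /and3P[ij pij]]]].
  have fi (x y : 'I_m.+3) : x < y -> f x < f y.
    by move=> xy; move/forallP: (fI x) => /(_ y); rewrite xy.
  have fv (x y : 'I_m.+3) : (p (f x) < p (f y)) = (q x < q y).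
    by move/forallP: (fV x) => /(_ y) /eqP.
  (* h lists the values of the occurrence in increasing order. *)
  pose g a : 'I_n := f (inord a).
  pose h a : nat := p (f (q (inord a))).
  have sorted2 (e : nat -> nat) :
      (forall x y, x < m.+3 -> y < m.+3 -> x < y -> e x < e y) ->
      path ltn (e 1) (map e (iota 2 m.+1)).
    move=> eI; rewrite path_map.
    have : path ltn 1 (iota 2 m.+1) := iota_ltn_sorted 1 m.+2.
    apply: (@sub_in_path _ (gtn m.+3)) => [x y|]; first exact: eI.
    by apply/allP => x; rewrite -[1 :: _]/(iota 1 m.+2) mem_iota inE /=; lia.
  have q_inord x : 1 < x -> x < m.+3 -> q (inord x) = inord x.
    move=> x1 xm; apply/val_inj; rewrite /= patternE inordK // x1 orbT //.
  exists (g 0), (g 1); apply/and3P; split.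
  - by apply: fi; rewrite !inordK.
  - by rewrite fv !patternE !inordK //; case: (b).
  apply/boardP; exists (map g (iota 2 m.+1)); split.
  - by rewrite size_map size_iota.
  - rewrite -map_comp; apply: (sorted2 (fun a => val (g a))) => x y xm ym xy.
    by apply: fi; rewrite !inordK.
  rewrite (_ : nat_of_ord _ = h 1); last first.
    rewrite /h /g.
    have -> : q (inord 1) = inord b.
      by apply/val_inj; rewrite /= patternE !inordK //; case: (b).
    by case: (b).
  rewrite -map_comp (_ : map _ _ = map h (iota 2 m.+1)); last first.
    apply/eq_in_map => x; rewrite mem_iota => xm.
    by rewrite /h /g /= q_inord //; lia.
  apply: sorted2 => x y xm ym xy.
  by rewrite /h fv !patternK !inordK.
case/boardP=> s [sz sx sv].
(* X lists the positions and V the values of the occurrence, both increasingly;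
   the value of rank q a is taken at the position of rank a. *)
pose f : {ffun 'I_m.+3 -> 'I_n} := [ffun a => nth i [:: i, j & s] (val a)].
pose X := [:: val i, val j & [seq val y | y <- s]].
pose V := if b then [:: val (p i), val (p j) & [seq val (p y) | y <- s]]
          else [:: val (p j), val (p i) & [seq val (p y) | y <- s]].
have sX : sorted ltn X by rewrite /X /= ij.
have sV : sorted ltn V.
  have pij' : p i != p j.
    by apply/eqP => /perm_inj eij; move: ij; rewrite eij ltnn.
  move: pij sv pij'; rewrite -val_eqE /V; case: (b) => /= /eqP hp -> ?; rewrite andbT //.
  by lia.
have zX : size X = m.+3 by rewrite /= size_map sz.
have zV : size V = m.+3 by rewrite /V; case: (b); rewrite /= size_map sz.
have fX (a : 'I_m.+3) : val (f a) = nth 0 X a.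
  rewrite ffunE -[X]/(map val [:: i, j & s]) (nth_map i) //=.
  by rewrite sz.
have fV (a : 'I_m.+3) : val (p (f a)) = nth 0 V (q a).
  rewrite /= patternE ffunE /V.
  case: a => [[|[|a]] am] /=; case: (b) => //=; rewrite (nth_map i) // sz; lia.
have mono (a c : 'I_m.+3) (W : seq nat) : sorted ltn W -> size W = m.+3 ->
    (nth 0 W a < nth 0 W c) = (a < c).
  move=> sW zW.
  have incr (y z : 'I_m.+3) : y < z -> nth 0 W y < nth 0 W z.
    by move=> yz; apply: (sorted_ltn_nth ltn_trans 0 sW); rewrite ?inE ?zW.
  case: (ltngtP a c) => [/incr -> //|/incr/ltnW|->]; last by rewrite ltnn.
  by rewrite leqNgt => /negPf.
exists f; apply/andP; split; apply/forallP=> a; apply/forallP=> c.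
  by apply/implyP; rewrite !fX mono.
by rewrite !fV mono.
Qed.

Lemma avoids_patternP (n m : nat) (b : bool) (p : 'S_n) :
  reflect (hit_free m.+1 b p) (avoids p (pattern b m.+3)).
Proof.
apply: (iffP negP) => [H i j|H /contains_patternP[i [j]]].
  by apply/negP => hij; apply: H; apply/contains_patternP; exists i, j.
by apply/negP/H.
Qed.

(** * One avoider in each class *)

(** Exchanging the entries of a descent increases the sum of all products
    position times value; for ascents the values are complemented. *)
Definition weight (n : nat) (b : bool) (p : 'S_n) : nat :=
  \sum_(x < n) x * (if b then n - p x else p x).

Lemma weight_swap (n l : nat) (b : bool) (p : 'S_n) (i j : 'I_n) :
  hit l b p i j -> weight b p < weight b (tperm i j * p)%g.
Proof.
case/and3P=> ij /eqP pij _.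
have ji : j != i by rewrite -val_eqE /=; lia.
rewrite /weight (bigD1 i) //= (bigD1 j) //= [ltnRHS](bigD1 i) //=.
rewrite [X in _ < _ + X](bigD1 j) //= !permM tpermL tpermR !addnA.
set S := \sum_(_ | _) _; set T := \sum_(_ | _) _.
have -> : T = S.
  apply: eq_bigr => x /andP[xi xj]; rewrite permM tpermD // eq_sym //.
rewrite ltn_add2r; clear S T.
have npi := ltn_ord (p i); have npj := ltn_ord (p j).
have pne : val (p i) != val (p j) by rewrite val_eqE (inj_eq perm_inj) eq_sym.
case: b pij => pij /=; move: ij pij npi npj pne; rewrite /=; nia.
Qed.

Lemma same_high_swap (n l : nat) (b : bool) (p : 'S_n) (i j : 'I_n) :
  hit l b p i j -> same_high l p (tperm i j * p)%g.
Proof.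
case/and3P=> ij /eqP pij bd.
have pne : val (p i) != val (p j) by rewrite val_eqE (inj_eq perm_inj) -val_eqE /=; lia.
have bji : board l p j (p i) by apply: board_le bd => //; case: b pij; lia.
have bjj : board l p j (p j) by apply: board_le bd => //; case: b pij; lia.
have ij' := ltnW ij.
apply/same_highP=> x; rewrite permM; case: tpermP => // -> _; split=> //.
  exact: board_le bji.
exact: board_le bjj.
Qed.

Lemma hit_free_exists (n l : nat) (b : bool) (p : 'S_n) :
  exists2 r, same_high l p r & hit_free l b r.
Proof.
have [r pr rmax] := @arg_maxnP _ p (same_high l p) (weight b) (same_high_refl l p).
exists r => // i j; apply/negP => hij.
have := rmax _ (same_high_trans pr (same_high_swap hij)).
by rewrite /= leqNgt (weight_swap hij).
Qed.

(** Let [j] be the last position where [p] and [r] differ.  The value [r j]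
    occurs in [p] to the left of [j], and together with [p j] it forms an ascent
    of [p] if [r j < p j] and a descent otherwise. *)
Lemma hit_of_last_difference (n l : nat) (b : bool) (p r : 'S_n) (j : 'I_n) :
  same_high l p r -> (forall x : 'I_n, j < x -> p x = r x) ->
  p j <> r j -> (r j < p j) = b -> exists i, hit l b p i j.
Proof.
move=> pr later prj rpj; have [lj bj] := same_highP _ _ _ pr j prj.
exists (p^-1 (r j))%g; rewrite /hit permKV rpj eqxx /=.
apply/andP; split; last by case: (b); [exact: lj | exact: bj].
set i := (p^-1 (r j))%g; have pi : p i = r j by rewrite permKV.
case: (ltngtP i j) => // [ji|/val_inj eij].
  by have := later _ ji; rewrite pi => /perm_inj eij; rewrite -eij ltnn in ji.
by case: prj; rewrite -pi eij.
Qed.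

Lemma hit_free_unique (n l : nat) (b : bool) (p r : 'S_n) :
  same_high l p r -> hit_free l b p -> hit_free l b r -> p = r.
Proof.
move=> pr hp hr; apply/permP=> x0; apply/eqP; apply/negPn/negP => ne0.
have [j nej jmax] := @arg_maxnP _ x0 (fun x => p x != r x) val ne0.
have later (x : 'I_n) : j < x -> p x = r x.
  by move=> jx; apply/eqP; apply/negPn/negP => /jmax /=; rewrite leqNgt jx.
have nejv : val (p j) != val (r j) by [].
have [rpj|prj] := eqVneq (r j < p j) b.
  by have [|i] := hit_of_last_difference pr later _ rpj; [exact/eqP|apply/negP].
have [| | |i] := @hit_of_last_difference n l b r p j (same_high_sym pr).
- by move=> x /later.
- by move/eqP; rewrite eq_sym (negPf nej).
- by case: b prj {hp hr} => /=; move: nejv => /=; lia.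
exact/negP.
Qed.

(** * Alternation *)

Lemma alternatingP (n : nat) (p : 'S_n) :
  reflect (forall i j : 'I_n, val j = i.+1 -> (p i < p j) = ~~ odd i)
          (alternating p).
Proof.
apply: (iffP forallP) => [H i j ij|H i].
  by move/forallP: (H i) => /(_ j); rewrite -ij eqxx => /eqP.
by apply/forallP => j; apply/implyP => /eqP ij; rewrite (H _ _ ij).
Qed.

Lemma low_high_ascent (n l : nat) (p : 'S_n) (i j : 'I_n) :
  0 < l -> val j = i.+1 -> low l p i -> ~~ low l p j -> p i < p j.
Proof.
move=> l0 ij li; apply: contraNltn => pji.
by apply: board_le (board_neighbour l0 ij pji li).
Qed.

Lemma high_low_descent (n l : nat) (p : 'S_n) (i j : 'I_n) :
  val j = i.+1 -> ~~ low l p i -> low l p j -> p j < p i.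
Proof.
move=> ij hi lj; move: hi; apply: contraNltn => pij.
by apply: board_le lj => //; rewrite -[nat_of_ord j]/(val j) ij.
Qed.

(** Positions being counted from 0, [p] ascends from even positions and descends
    from odd ones.  For the increasing pattern, adjacent low entries form a
    descent, so the entry preceding both exists and forms a forbidden ascent
    with the first of them.  For the swapped pattern, adjacent low entries form
    an ascent by [board_neighbour]; the second of them and the entry following
    it then form a forbidden descent, again by [board_neighbour]. *)
Lemma low_not_adjacent (n l : nat) (b : bool) (p : 'S_n) (i j : 'I_n) :
  0 < l -> alternating p -> hit_free l b p -> val j = i.+1 ->
  low l p i -> ~~ low l p j.
Proof.
move=> l0 /alternatingP alt hf ij li; apply/negP => lj.
have ltij : i < j by rewrite -[nat_of_ord j]/(val j) ij.
have altij := alt _ _ ij.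
case: b hf => hf.
  have [pij|pij] := boolP (p i < p j).
    by move: (hf i j); rewrite /hit ltij pij eqxx [board _ _ _ _]lj.
  (* The descent starts at the odd position i, which therefore has a left
     neighbour; its entry is below p i. *)
  have oi : odd i by move: pij; rewrite altij negbK.
  have i0 : 0 < i by case: (nat_of_ord i) oi.
  have hn : i.-1 < n by apply: leq_ltn_trans (leq_pred _) (ltn_ord i).
  have hi : val i = (Ordinal hn).+1 by rewrite /= prednK.
  move: (hf (Ordinal hn) i); rewrite /hit (alt _ _ hi) [board _ _ _ _]li /=.
  by rewrite ltn_predL i0; move: oi; rewrite -{1}(prednK i0) /= => ->.
have [pij|] := boolP (p i < p j); last first.
  move=> pij; move: (hf i j); rewrite /hit ltij (negPf pij) eqxx /=.
  by rewrite (board_neighbour l0 ij _ li) // leqNgt.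
have oi : ~~ odd i by rewrite -altij.
(* The chain above the low entry at j lies to its right, so j is not the last
   position. *)
have hn : j.+1 < n.
  case/boardP: lj => -[|x s] [sz sx _]; first by rewrite -sz in l0.
  by case/andP: sx => jx _; apply: leq_ltn_trans jx (ltn_ord x).
have altj := alt j (Ordinal hn) erefl.
have oj : odd j by rewrite -[nat_of_ord j]/(val j) ij.
rewrite oj /= in altj.
move: (hf j (Ordinal hn)); rewrite /hit /= leqnn altj /=.
by rewrite (@board_neighbour n l p j (Ordinal hn)) // leqNgt altj.
Qed.

Lemma same_high_alternating (n l : nat) (b : bool) (p r : 'S_n) :
  0 < l -> hit_free l b p -> same_high l p r ->
  alternating p -> alternating r.
Proof.
move=> l0 hf pr alt; apply/alternatingP=> i j ij.
have nadj := low_not_adjacent l0 alt hf ij.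
rewrite -(alternatingP _ alt i j ij).
have [li|hi] := boolP (low l p i).
  have hj := nadj li.
  rewrite (low_high_ascent l0 ij li hj).
  by rewrite (@low_high_ascent n l r i j) // (same_high_low _ pr).
have [lj|hj] := boolP (low l p j).
  rewrite (ltnNge (p i)) (ltnW (high_low_descent ij hi lj)).
  rewrite ltnNge (ltnW (@high_low_descent n l r i j ij _ _)) //.
    by rewrite (same_high_low _ pr).
  by rewrite (same_high_low _ pr).
by rewrite (same_high_eq pr hi) (same_high_eq pr hj).
Qed.

(** Sending an alternating avoider of one pattern to an avoider of the other one
    in its class is injective, by uniqueness in the class, and preserves
    alternation. *)
Lemma num_alt_avoiding_le (n m : nat) (b c : bool) :
  num_alt_avoiding n (pattern b m.+3) <= num_alt_avoiding n (pattern c m.+3).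
Proof.
pose T (p r : 'S_n) := same_high m.+1 p r && avoids r (pattern c m.+3).
have exT p : exists r, T p r.
  have [r pr hr] := hit_free_exists m.+1 c p.
  by exists r; rewrite /T pr; apply/avoids_patternP.
pose f p := xchoose (exT p).
have fP p : T p (f p) := xchooseP (exT p).
rewrite /num_alt_avoiding -(@card_in_imset _ _ f); last first.
  move=> p r; rewrite !inE => /andP[_ /avoids_patternP hp] /andP[_ /avoids_patternP hr] fpr.
  have /andP[pf _] := fP p; have /andP[/same_high_sym fr _] := fP r.
  by rewrite -fpr in fr; apply: hit_free_unique (same_high_trans pf fr) hp hr.
apply/subset_leq_card/subsetP => _ /imsetP[p + ->].
rewrite !inE => /andP[ap /avoids_patternP hp]; have /andP[pf ->] := fP p.
by rewrite andbT (same_high_alternating _ hp pf ap).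
Qed.

Theorem theorem3p4 (n : nat) (hn : 0 < n) (k : nat) (hk : 3 <= k) :
  num_alt_avoiding n (increasing_pattern k) =
  num_alt_avoiding n (swapped_pattern k).
Proof.
case: k hk => [|[|[|m]]] // _; apply/eqP; rewrite eqn_leq.
by rewrite (num_alt_avoiding_le n m true false) (num_alt_avoiding_le n m false true).
Qed.
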